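(* Let $X$ be a random matrix with values in $\mathcal{S}_d$ and $A \in \mathcal{S}_d^{++}$ a deterministic matrix. Then $$\mathbb{P}(|X-\mathbb{E} X| \succeq A) \leq \frac{1}{d}\operatorname{tr}\left(\mathbb{E}\left[\left(|X-\mathbb{E} X| A^{-1}\right)^2\right]\right).$$ More generally, for every real $p \geq 1$, $$\mathbb{P}(|X-\mathbb{E} X| \succeq A) \leq \frac{1}{d}\operatorname{tr}\left(\mathbb{E}\left[\left(|X-\mathbb{E} X| A^{-1}\right)^p\right]\right).$$ Moreover, for every real $0< q\leq 1$, $$\mathbb{P}(|X-\mathbb{E} X| \succeq A) \leq \frac{1}{d} \operatorname{tr}\left(\left[\mathbb{E}\left|X-\mathbb{E} X\right|^q\right] A^{-q}\right).$$
   Context: $\mathcal{S}_d$ denotes the set of $d\times d$ real symmetric matrices, and $\mathcal{S}_d^{++}$ the positive definite ones. The Loewner order: for $A,B\in\mathcal{S}_d$, $A \preceq B$ (equivalently $B\succeq A$) means $B-A$ is positive semidefinite. Scalar functions (such as $|\cdot|$, and powers of positive semidefinite matrices) are applied to symmetric matrices through orthogonal diagonalization, i.e. by applying the function to the eigenvalues. For $B\in\mathcal{S}_d$ positive semidefinite, the matrix $BA^{-1}$ need not be symmetric, but it is diagonalizable with nonnegative eigenvalues, since $BA^{-1}=A^{1/2}(A^{-1/2}BA^{-1/2})A^{-1/2}$; its $p$-th power is $(BA^{-1})^p=A^{1/2}(A^{-1/2}BA^{-1/2})^pA^{-1/2}$, which agrees with the usual power for integer $p$. Expectations of random matrices are taken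 entrywise and are assumed to exist when written. *)

(* Defs.v *)
From HB Require Import structures.
From mathcomp Require Import all_boot all_order all_algebra.
From mathcomp Require Import all_classical all_reals all_analysis.

Set Implicit Arguments.
Unset Strict Implicit.
Unset Printing Implicit Defensive.

Import Order.TTheory GRing.Theory Num.Theory.

Local Open Scope classical_set_scope.
Local Open Scope ring_scope.

Section SymmetricMatrices.
Context {R : realType} {d : nat}.
Implicit Types (f : R -> R) (A B U : 'M[R]_d) (v : 'rV[R]_d) (s : R).

Definition psdmx A : Prop :=
  A \is symmetricmx /\ forall x : 'rV[R]_d, 0 <= (x *m A *m x^T) 0 0.

Definition pdmx A : Prop :=
  A \is symmetricmx /\
  forall x : 'rV[R]_d, x != 0 -> 0 < (x *m A *m x^T) 0 0.

Definition loewner_le A B : Prop := psdmx (B - A).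

Definition orthogonally_diagonalizes U v A : Prop :=
  U *m U^T = 1%:M /\ A = U^T *m diag_mx v *m U.

(* The value does not depend on the diagonalization (mxfunE below).  A real
   symmetric matrix always has one, so the default 0 of xget is only reached
   when A is not symmetric. *)
Definition mxfun f A : 'M[R]_d :=
  xget 0 [set B | exists U v, orthogonally_diagonalizes U v A /\
                              B = U^T *m diag_mx (map_mx f v) *m U].

Definition mxabs A : 'M[R]_d := mxfun (fun t => `|t|) A.

(* The library's t `^ s is the usual real power for t > 0, and 0 `^ s = 0 for
   s != 0.  For t < 0 it is a junk value: only meaningful if A is positive
   semidefinite (positive definite when s < 0). *)
Definition mxpow A s : 'M[R]_d := mxfun (fun t => t `^ s) A.

(* (B A^-1)^p, which is not a functional calculus of a symmetric matrix:
   A^(1/2) (A^(-1/2) B A^(-1/2))^p A^(-1/2), for A positive definite and B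
   positive semidefinite. *)
Definition mxdiv_pow B A (p : R) : 'M[R]_d :=
  let A12 := mxpow A (2^-1) in
  let A12V := mxpow A (- 2^-1) in
  A12 *m mxpow (A12V *m B *m A12V) p *m A12V.

Lemma mxfunE f U v A : orthogonally_diagonalizes U v A ->
  mxfun f A = U^T *m diag_mx (map_mx f v) *m U.
Proof.
move=> UvA; rewrite /mxfun; case: xgetP => [B _ [U' [v' [U'v'A ->]]]|]; last first.
  by move=> /(_ (U^T *m diag_mx (map_mx f v) *m U)) []; exists U, v.
case: UvA U'v'A => UU -> [U'U' AE].
have UTU : U^T *m U = 1%:M by exact: mulmx1C.
have U'TU' : U'^T *m U' = 1%:M by exact: mulmx1C.
pose W := U' *m U^T.
have WE : W *m diag_mx v = diag_mx v' *m W.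
  have : U' *m (U^T *m diag_mx v *m U) *m U^T =
         U' *m (U'^T *m diag_mx v' *m U') *m U^T by rewrite AE.
  by rewrite !mulmxA U'U' mul1mx -!mulmxA UU mulmx1 /W !mulmxA.
have WfE : W *m diag_mx (map_mx f v) = diag_mx (map_mx f v') *m W.
  apply/matrixP => i j; move/matrixP/(_ i j): WE.
  rewrite !mul_mx_diag !mul_diag_mx !mxE => WE.
  have [W0|W0] := eqVneq (W i j) 0.
    by move: W0; rewrite /W mxE => ->; rewrite mul0r mulr0.
  move: W0 WE; rewrite /W mxE mulrC => W0 /(mulIf W0) ->.
  by rewrite mulrC.
have : U'^T *m (W *m diag_mx (map_mx f v)) *m U =
       U'^T *m (diag_mx (map_mx f v') *m W) *m U by rewrite WfE.
by rewrite /W !mulmxA U'TU' mul1mx -!mulmxA UTU mulmx1 => ->.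
Qed.

End SymmetricMatrices.

Notation "A ⪯ B" := (loewner_le A B) (at level 70, no associativity) : ring_scope.

Section RandomMatrices.
Context {disp : measure_display} {T : measurableType disp} {R : realType}.
Context {d : nat}.
Implicit Types (P : probability T R) (X : T -> 'M[R]_d).

Definition random_symmx X : Prop :=
  (forall i j, measurable_fun setT (fun w => X w i j)) /\
  (forall w, X w \is symmetricmx).

Definition mx_integrable P X : Prop :=
  forall i j, P.-integrable setT (fun w => (X w i j)%:E).

(* fine sends infinite values to 0: only meaningful under mx_integrable. *)
Definition mx_expectation P X : 'M[R]_d :=
  \matrix_(i, j) fine 'E_P[fun w => X w i j].

End RandomMatrices.

(* Main.v *)
Require Import Defs.
From HB Require Import structures.
From mathcomp Require Import all_boot all_order all_algebra.
From mathcomp Require Import all_classical all_reals all_analysis.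
From mathcomp Require Import measurable_realfun complex ring lra.

(* Each bound is Markov's inequality for a nonnegative trace that is at least d
   on the event A ⪯ Y, where Y = |X - E X|.  For the p-th power, the trace is
   that of C^p with C = A^(-1/2) Y A^(-1/2), whose eigenvalues are at least 1 on
   the event.  For the q-th power, tr (Y^q A^(-q)) is the trace of a positive
   semidefinite matrix of determinant (det Y / det A)^q >= 1, so AM-GM on its
   eigenvalues gives the bound d; no operator monotonicity of t^q is needed.
   The event is measurable because a symmetric Z is positive semidefinite iff
   tr |Z| <= tr Z, and |Z| is a pointwise limit of polynomials in Z with
   measurable coefficients. *)

Set Implicit Arguments.
Unset Strict Implicit.
Unset Printing Implicit Defensive.

Import Order.TTheory GRing.Theory Num.Theory numFieldNormedType.Exports.

Local Open Scope classical_set_scope.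
Local Open Scope ring_scope.

Lemma symmetricmxP {R : fieldType} {n} (A : 'M[R]_n) :
  reflect (A^T = A) (A \is symmetricmx).
Proof.
rewrite is_hermitianmxE expr0 scale1r map_mx_id // eq_sym; exact: eqP.
Qed.

(** * Spectral theorem for real symmetric matrices *)

Section SpectralTheorem.
Context {R : realType}.

(** Over the complex numbers the matrix is normal with real spectrum. Its characteristic polynomial
    is the image of the real one, so a real root found there is already a root over [R]. *)
Lemma symmetricmx_eigenvalue {n} (A : 'M[R]_n.+1) :
  A \is symmetricmx -> exists r, eigenvalue A r.
Proof.
move=> /symmetricmxP As; pose B := map_mx (real_complex R) A.
have Bs : B \is symmetricmx by apply/symmetricmxP; rewrite map_trmx As.
have Br : B \is a realmx.
  by apply/mxOverP => i j; rewrite mxE; apply/complex_realP; exists (A i j).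
have /orthomx_spectralP := symmetric_normalmx Bs Br.
have /mxOverP/(_ 0 0)/RRe_real :=
  hermitian_spectral_diag_real (realsym_hermsym Bs Br).
set P := spectralmx B; set D := spectral_diag B => Dr BE.
exists (complex.Re (D 0 0)).
have : eigenvalue B (D 0 0).
  (* From [P *m B = diag_mx D *m P], each row of [P] is an eigenvector, and it is nonzero because
     [P] is invertible. *)
  apply/eigenvalueP; exists (row 0 P); last first.
    apply: contraTneq (spectral_unit B) => P0.
    rewrite unitmxE (expand_det_row _ 0) big1 ?unitr0// => j _; rewrite -/P.
    by move/rowP/(_ j): P0; rewrite !mxE => ->; rewrite mul0r.
  rewrite {1}BE -row_mul !mulmxA mulmxV ?spectral_unit// mul1mx.
  by apply/rowP => j; rewrite mxE mul_diag_mx !mxE.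
by rewrite !eigenvalue_root_char -Dr -map_char_poly fmorph_root.
Qed.

Lemma dotmx_ge0 {n} (x : 'rV[R]_n) : 0 <= (x *m x^T) 0 0.
Proof. by rewrite mxE sumr_ge0// => i _; rewrite mxE -expr2 sqr_ge0. Qed.

Lemma dotmx_eq0 {n} (x : 'rV[R]_n) : ((x *m x^T) 0 0 == 0) = (x == 0).
Proof.
rewrite mxE psumr_eq0; last by move=> i _; rewrite mxE -expr2 sqr_ge0.
apply/allP/eqP => [x0|-> i _]; last by rewrite /= !mxE mulr0 eqxx.
apply/rowP => i; have := x0 i (mem_index_enum i).
by rewrite /= !mxE mulf_eq0 orbb => /eqP.
Qed.

(* Householder: reflect in the hyperplane orthogonal to x - y. *)
Lemma unit_rows_reflection {n} (x y : 'rV[R]_n) :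
  (x *m x^T) 0 0 = 1 -> (y *m y^T) 0 0 = 1 ->
  exists H : 'M[R]_n, [/\ H^T = H, H *m H = 1%:M & x *m H = y].
Proof.
move=> x1 y1; have [<-|xy] := eqVneq x y.
  by exists 1%:M; rewrite trmx1 !mulmx1.
pose w := x - y; pose c := (w *m w^T) 0 0.
have c0 : c != 0 by rewrite dotmx_eq0 subr_eq0.
have ww : w *m w^T = c%:M by rewrite [LHS]mx11_scalar.
exists (1%:M - (2 / c) *: (w^T *m w)); split.
- by rewrite linearB/= linearZ/= trmx_mul trmxK trmx1.
- have kc : 2 / c * c = 2 by rewrite divfK.
  move: (2 / c) kc => k kc.
  have XX : (w^T *m w) *m (w^T *m w) = c *: (w^T *m w).
    by rewrite mulmxA -(mulmxA w^T) ww mul_mx_scalar -scalemxAl.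
  move: (w^T *m w) XX => W XX.
  rewrite mulmxBl mul1mx mulmxBr mulmx1 -scalemxAl -scalemxAr XX !scalerA.
  rewrite opprB -addrA -!scaleNr -!scalerDl.
  by rewrite [X in X *: _](_ : _ = 0) ?scale0r ?addr0// -mulrA kc; ring.
- rewrite mulmxBr mulmx1 -scalemxAr mulmxA.
  have yx : (y *m x^T) 0 0 = (x *m y^T) 0 0.
    by rewrite -[y *m x^T]trmxK trmx_mul trmxK mxE.
  (* Both rows have norm 1, so with this value of [c] the coefficient of [w] in the image of [x] is
     1, and the image is [x - w = y]. *)
  have cE : c = 2 * (1 - (x *m y^T) 0 0).
    rewrite /c /w linearB/= mulmxBl !mulmxBr.
    by rewrite !mxE in x1 y1 yx *; rewrite x1 y1 yx; ring.
  have -> : x *m w^T = (1 - (x *m y^T) 0 0)%:M.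
    rewrite [LHS]mx11_scalar; congr (_%:M).
    by rewrite /w linearB/= mulmxBr; rewrite !mxE in x1 *; rewrite x1.
  rewrite mul_scalar_mx scalerA.
  by rewrite (_ : _ * _ = 1) ?scale1r ?subKr// mulrAC -cE mulfV.
Qed.

(** Induction on the size. A reflection [H] exchanging the first basis row and a unit eigenvector
    makes [H *m A *m H] block diagonal, by symmetry, and the induction hypothesis diagonalizes the
    lower block. *)
Theorem real_spectral {n} (A : 'M[R]_n) : A \is symmetricmx ->
  exists U v, orthogonally_diagonalizes U v A.
Proof.
elim: n A => [|n IHn] A As.
  by exists 1%:M, 0; split; apply/matrixP => -[].
have [r /eigenvalueP[x xA x0]] := symmetricmx_eigenvalue As.
pose c := (x *m x^T) 0 0.
have c0 : 0 < c by rewrite lt_def dotmx_eq0 x0 dotmx_ge0.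
pose y := (Num.sqrt c)^-1 *: x.
have y1 : (y *m y^T) 0 0 = 1.
  rewrite /y linearZ/= -scalemxAl -scalemxAr scalerA mxE -/c.
  by rewrite -invfM -expr2 sqr_sqrtr ?ltW// mulVf ?gt_eqF.
have yA : y *m A = r *: y by rewrite /y -scalemxAl xA scalerA mulrC -scalerA.
pose e : 'rV[R]_n.+1 := delta_mx 0 0.
have e1 : (e *m e^T) 0 0 = 1 by rewrite trmx_delta mul_delta_mx mxE !eqxx.
have [H [HT HH eH]] := unit_rows_reflection e1 y1.
have yH : y *m H = e by rewrite -eH -mulmxA HH mulmx1.
have [B BdE] : {B : 'M[R]_(1 + n) | B = H *m A *m H} by exists (H *m A *m H).
have BT : B^T = B by rewrite BdE !trmx_mul HT (symmetricmxP _ As) mulmxA.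
have eB : e *m B = r *: e by rewrite BdE !mulmxA eH yA -scalemxAl yH.
have B0 j : B 0 j = r *+ (j == 0).
  move/rowP/(_ j): eB; rewrite -rowE !mxE eqxx /= => ->.
  by rewrite mulr_natr.
have BE : B = block_mx r%:M 0 0 (drsubmx B).
  rewrite -[LHS]submxK; congr block_mx.
  - by apply/matrixP => i j; rewrite !ord1 !mxE lshift0 B0.
  - by apply/matrixP => i j; rewrite !ord1 !mxE lshift0 B0.
  - apply/matrixP => i j; rewrite !ord1 !mxE lshift0.
    by rewrite -BT mxE B0.
have Cs : drsubmx B \is symmetricmx.
  by apply/symmetricmxP; rewrite trmx_drsub BT.
have [V [v [VV CE]]] := IHn _ Cs.
pose W : 'M[R]_(1 + n) := block_mx 1%:M 0 0 V.
have WW : W *m W^T = 1%:M.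
  rewrite /W tr_block_mx trmx1 !trmx0 mulmx_block.
  by rewrite !(mulmx0, mul0mx, mulmx1, addr0, add0r) VV -scalar_mx_block.
exists (W *m H), (row_mx r%:M v : 'rV_(1 + n)); split.
  by rewrite trmx_mul HT mulmxA -(mulmxA W) HH mulmx1.
rewrite trmx_mul HT -!mulmxA.
suff WB : W^T *m (diag_mx (row_mx r%:M v : 'rV_(1 + n)) *m W) = B.
  rewrite (mulmxA (diag_mx _)) (mulmxA W^T) WB BdE !mulmxA HH mul1mx.
  by rewrite -mulmxA HH mulmx1.
rewrite /W tr_block_mx trmx1 !trmx0 diag_mx_row.
rewrite !mulmx_block !(mulmx0, mul0mx, mulmx1, mul1mx, addr0, add0r).
rewrite BE CE mulmxA; congr block_mx.
by apply/matrixP => i j; rewrite !ord1 !mxE.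
Qed.

End SpectralTheorem.

(** * Definiteness, trace and determinant through eigenvalues *)

Section FunctionalCalculus.
Context {R : realType} {d : nat}.
Implicit Types (p q s t : R) (A B S U Y : 'M[R]_d) (v x : 'rV[R]_d) (f g : R -> R).

Lemma orthogonally_diagonalizes_sym U v A :
  orthogonally_diagonalizes U v A -> A \is symmetricmx.
Proof.
by move=> [_ ->]; apply/symmetricmxP; rewrite !trmx_mul trmxK tr_diag_mx mulmxA.
Qed.

Lemma orthogonally_diagonalizes_mxfun U v A f :
  orthogonally_diagonalizes U v A ->
  orthogonally_diagonalizes U (map_mx f v) (mxfun f A).
Proof. by move=> UvA; rewrite (mxfunE _ UvA); split=> //; case: UvA. Qed.

Lemma orthogonally_diagonalizes_tr U v A :
  orthogonally_diagonalizes U v A -> \tr A = \sum_i v 0 i.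
Proof.
move=> [UU ->]; rewrite mxtrace_mulC mulmxA UU mul1mx; exact: mxtrace_diag.
Qed.

Lemma orthogonally_diagonalizes_det U v A :
  orthogonally_diagonalizes U v A -> \det A = \prod_i v 0 i.
Proof.
move=> [UU ->]; rewrite !det_mulmx mulrAC -det_mulmx (mulmx1C UU) det1 mul1r.
exact: det_diag.
Qed.

Lemma orthogonally_diagonalizes_sub1 U v A :
  orthogonally_diagonalizes U v A ->
  orthogonally_diagonalizes U (v - const_mx 1) (A - 1%:M).
Proof.
move=> [UU ->]; split=> //; rewrite raddfB/= diag_const_mx mulmxBr mulmxBl mulmx1.
by rewrite (mulmx1C UU).
Qed.

Lemma quadform_diag U v A x : orthogonally_diagonalizes U v A ->
  (x *m A *m x^T) 0 0 = \sum_i v 0 i * (x *m U^T) 0 i ^+ 2.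
Proof.
move=> [_ ->]; rewrite !mulmxA -mulmxA -{2}[U]trmxK -trmx_mul mxE.
by apply: eq_bigr => i _; rewrite mul_mx_diag !mxE; ring.
Qed.

(** Row [i] of [U] becomes a basis vector in the eigenbasis. Testing the quadratic form there
    transfers its sign to the eigenvalues. *)
Lemma quadform_row U v A i : orthogonally_diagonalizes U v A ->
  (row i U *m A *m (row i U)^T) 0 0 = v 0 i.
Proof.
move=> UvA; rewrite (quadform_diag _ UvA); case: UvA => UU _.
rewrite (bigD1 i)//= big1 => [|j ij]; rewrite -row_mul UU !mxE ?eqxx.
  by rewrite expr1n mulr1 addr0.
by rewrite eq_sym (negbTE ij) expr0n mulr0.
Qed.

Lemma psdmx_diag U v A : orthogonally_diagonalizes U v A ->
  psdmx A <-> forall i, 0 <= v 0 i.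
Proof.
move=> UvA; split=> [[_ A0] i|v0]; first by rewrite -(quadform_row i UvA).
split=> [|x]; first exact: orthogonally_diagonalizes_sym UvA.
rewrite (quadform_diag _ UvA) sumr_ge0// => i _.
by rewrite mulr_ge0 ?sqr_ge0.
Qed.

Lemma pdmx_diag U v A : orthogonally_diagonalizes U v A ->
  pdmx A -> forall i, 0 < v 0 i.
Proof.
move=> UvA [_ A0] i; rewrite -(quadform_row i UvA) A0//.
case: UvA => /matrixP/(_ i i) + _; apply: contra_eq_neq => Ui0.
rewrite !mxE eqxx big1 1?eq_sym ?oner_eq0// => j _.
by move/rowP/(_ j): Ui0; rewrite !mxE => ->; rewrite mul0r.
Qed.

Lemma symmetricmxB A B :
  A \is symmetricmx -> B \is symmetricmx -> A - B \is symmetricmx.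
Proof.
move=> /symmetricmxP As /symmetricmxP Bs; apply/symmetricmxP.
by rewrite linearB/= As Bs.
Qed.

Lemma psdmx_congr A S : psdmx A -> psdmx (S *m A *m S^T).
Proof.
move=> [/symmetricmxP As A0]; split.
  by apply/symmetricmxP; rewrite !trmx_mul trmxK As mulmxA.
by move=> x; rewrite !mulmxA -mulmxA -trmx_mul.
Qed.

Lemma mxfun_sym f A : A \is symmetricmx -> mxfun f A \is symmetricmx.
Proof.
move=> /real_spectral[U [v UvA]].
exact: orthogonally_diagonalizes_sym (orthogonally_diagonalizes_mxfun f UvA).
Qed.

Lemma mxfun_psd f A : (forall t, 0 <= f t) -> A \is symmetricmx ->
  psdmx (mxfun f A).
Proof.
move=> f0 /real_spectral[U [v UvA]].
by apply/(psdmx_diag (orthogonally_diagonalizes_mxfun f UvA)) => i; rewrite mxE.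
Qed.

Lemma psdmx_tr_ge0 A : psdmx A -> 0 <= \tr A.
Proof.
move=> /[dup] -[/real_spectral[U [v UvA]] _] /(psdmx_diag UvA) v0.
by rewrite (orthogonally_diagonalizes_tr UvA) sumr_ge0.
Qed.

(** AM-GM on the eigenvalues: a trace below [d] would give them a mean below 1, whose [d]-th power
    bounds the determinant. *)
Lemma psdmx_det_ge1_tr A : psdmx A -> 1 <= \det A -> d%:R <= \tr A.
Proof.
move=> /[dup] -[/real_spectral[U [v UvA]] _] /(psdmx_diag UvA) v0.
rewrite (orthogonally_diagonalizes_tr UvA) (orthogonally_diagonalizes_det UvA).
move=> v1; rewrite leNgt; apply/negP => vd.
(* The contradiction hypothesis forces [d] to be positive, as the trace is nonnegative. *)
have d0 : (0 : R) < d%:R by apply: le_lt_trans vd; rewrite sumr_ge0.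
have [+ _] := @leif_AGM _ _ 'I_d (fun i => v 0 i) (fun i _ => v0 i).
rewrite card_ord; apply/negP; rewrite -ltNge (lt_le_trans _ v1)// exprn_ilt1//.
- by rewrite -lt0n -(ltr0n R).
- by rewrite divr_ge0// sumr_ge0.
- by rewrite ltr_pdivrMr// mul1r.
Qed.

(** The difference of the traces is the sum of the terms [|t| - t] over the eigenvalues [t]; each is
    nonnegative, and positive exactly when [t < 0]. *)
Lemma psdmx_tr_mxabs A : A \is symmetricmx ->
  psdmx A <-> \tr (mxabs A) <= \tr A.
Proof.
move=> /real_spectral[U [v UvA]].
have aA := orthogonally_diagonalizes_mxfun (fun t => `|t|) UvA.
rewrite (psdmx_diag UvA) (orthogonally_diagonalizes_tr UvA).
rewrite (orthogonally_diagonalizes_tr aA).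
split=> [v0|]; first by apply: ler_sum => i _; rewrite mxE ger0_norm.
rewrite -subr_le0 -sumrB => s0 i; move: s0; apply: contraTT; rewrite -!ltNge => vi.
rewrite (bigD1 i)//= ltr_pwDl ?mxE//.
  by rewrite subr_gt0 (lt_le_trans vi).
by apply: sumr_ge0 => j _; rewrite mxE subr_ge0 ler_norm.
Qed.

(** * Real matrix powers and the trace bounds they satisfy *)

Lemma mxpowD A s t : pdmx A -> mxpow A s *m mxpow A t = mxpow A (s + t).
Proof.
move=> /[dup] -[/real_spectral[U [v UvA]] _] /(pdmx_diag UvA) v0.
rewrite /mxpow !(mxfunE _ UvA); case: UvA => UU _.
rewrite !mulmxA -(mulmxA _ U) UU mulmx1 -(mulmxA U^T) mulmx_diag.
congr (_ *m _ *m _); congr diag_mx; apply/rowP => i; rewrite !mxE powRD//.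
(* When [s + t = 0] the law of exponents fails at 0, hence the need for nonzero eigenvalues. *)
by apply/implyP => _; rewrite gt_eqF// v0.
Qed.

Lemma mxpow0 A : pdmx A -> mxpow A 0 = 1%:M.
Proof.
move=> [/real_spectral[U [v UvA]] _]; rewrite /mxpow (mxfunE _ UvA).
rewrite (_ : map_mx _ _ = const_mx 1); last by apply/rowP => i; rewrite !mxE powRr0.
by rewrite diag_const_mx mulmx1; apply: mulmx1C; case: UvA.
Qed.

Lemma mxpow1 A : pdmx A -> mxpow A 1 = A.
Proof.
move=> /[dup] -[/real_spectral[U [v UvA]] _] /(pdmx_diag UvA) v0.
rewrite /mxpow (mxfunE _ UvA); case: UvA => UU AE; rewrite [RHS]AE.
congr (_ *m _ *m _); congr diag_mx; apply/rowP => i; rewrite !mxE powRr1//.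
exact: ltW.
Qed.

Lemma mxpowN1 A : pdmx A -> mxpow A (-1) = invmx A.
Proof.
move=> Ap; have AA : mxpow A (-1) *m A = 1%:M.
  by rewrite -{2}(mxpow1 Ap) mxpowD// addNr mxpow0.
have [_ uA] := mulmx1_unit AA.
by rewrite -[LHS]mulmx1 -(mulmxV uA) mulmxA AA mul1mx.
Qed.

Lemma det_mxpow A s : psdmx A -> \det (mxpow A s) = \det A `^ s.
Proof.
move=> /[dup] -[/real_spectral[U [v UvA]] _] /(psdmx_diag UvA) v0.
have UvAs := orthogonally_diagonalizes_mxfun (fun t => t `^ s) UvA.
rewrite (orthogonally_diagonalizes_det UvA) (orthogonally_diagonalizes_det UvAs).
under eq_bigr do rewrite mxE.
(* Nonnegativity of the partial product is carried along because [powRM] requires it. *)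
suff [] : \prod_i v 0 i `^ s = (\prod_i v 0 i) `^ s /\ 0 <= \prod_i v 0 i by [].
elim/big_rec2: _ => [|i x y _ [-> x0]]; first by rewrite powR1.
by rewrite powRM// mulr_ge0.
Qed.

Lemma pdmx_psdmx A : pdmx A -> psdmx A.
Proof.
move=> [As A0]; split=> // x; have [->|/A0/ltW//] := eqVneq x 0.
by rewrite !mul0mx mxE.
Qed.

Lemma pdmx_det_gt0 A : pdmx A -> 0 < \det A.
Proof.
move=> /[dup] -[/real_spectral[U [v UvA]] _] /(pdmx_diag UvA) v0.
by rewrite (orthogonally_diagonalizes_det UvA) prodr_gt0.
Qed.

(** For [A] positive definite this is similar to [Y *m invmx A], but it stays symmetric when [Y] is,
    so the spectral theorem applies to it. *)
Definition whiten A Y := mxpow A (- 2^-1) *m Y *m mxpow A (- 2^-1).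

Lemma mxpow_tr A s : pdmx A -> (mxpow A s)^T = mxpow A s.
Proof. by move=> [As _]; apply/symmetricmxP/mxfun_sym. Qed.

Lemma mxpow_halfN A : pdmx A -> mxpow A (- 2^-1) *m mxpow A (- 2^-1) = invmx A.
Proof.
move=> Ap; rewrite (mxpowD _ _ Ap) -(mxpowN1 Ap).
by rewrite (_ : _ + _ = -1) //; field.
Qed.

Lemma whiten_psd A Y : pdmx A -> psdmx Y -> psdmx (whiten A Y).
Proof.
by move=> Ap /(psdmx_congr (mxpow A (- 2^-1))); rewrite mxpow_tr.
Qed.

(** Congruence preserves the Loewner order, and this one carries [A] to the identity. *)
Lemma whiten_ge1 A Y : pdmx A -> loewner_le A Y -> psdmx (whiten A Y - 1%:M).
Proof.
move=> Ap /(psdmx_congr (mxpow A (- 2^-1))); rewrite mxpow_tr// mulmxBr mulmxBl.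
congr (psdmx (_ - _)); rewrite -{2}(mxpow1 Ap) !(mxpowD _ _ Ap) -(mxpow0 Ap).
by rewrite (_ : _ + _ + _ = 0) //; field.
Qed.

(** Cyclicity of the trace brings the two outer powers of [A] together, where they cancel. *)
Lemma tr_mxdiv_pow A Y p : pdmx A ->
  \tr (mxdiv_pow Y A p) = \tr (mxpow (whiten A Y) p).
Proof.
move=> Ap; rewrite /mxdiv_pow mxtrace_mulC mulmxA (mxpowD _ _ Ap) addNr (mxpow0 Ap).
by rewrite mul1mx.
Qed.

Lemma tr_mxdiv_pow_ge0 A Y p : pdmx A -> psdmx Y -> 0 <= \tr (mxdiv_pow Y A p).
Proof.
move=> Ap Yp; rewrite tr_mxdiv_pow//; apply/psdmx_tr_ge0/mxfun_psd.
  by move=> t; exact: powR_ge0.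
by have [] := whiten_psd Ap Yp.
Qed.

(** The eigenvalues of [whiten A Y] are at least 1, hence so are their [p]-th powers, and there are
    [d] of them. *)
Lemma tr_mxdiv_pow_ge A Y p : pdmx A -> psdmx Y -> loewner_le A Y -> 0 <= p ->
  d%:R <= \tr (mxdiv_pow Y A p).
Proof.
move=> Ap Yp AY p0; rewrite tr_mxdiv_pow//.
have [/real_spectral[U [v UvC]] _] := whiten_psd Ap Yp.
have := whiten_ge1 Ap AY => /(psdmx_diag (orthogonally_diagonalizes_sub1 UvC)) v1.
rewrite (orthogonally_diagonalizes_tr (orthogonally_diagonalizes_mxfun _ UvC)).
rewrite -[d in d%:R]card_ord -sumr_const; apply: ler_sum => i _; rewrite mxE.
have {}v1 : 1 <= v 0 i by have := v1 i; rewrite !mxE subr_ge0.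
have := ge0_ler_powR p0 _ _ v1; rewrite powR1; apply; rewrite nnegrE//.
exact: (le_trans ler01 v1).
Qed.

(** The ratio [\det Y / \det A] is the determinant of [whiten A Y], a product of eigenvalues that
    are at least 1. *)
Lemma loewner_le_det A Y : pdmx A -> psdmx Y -> loewner_le A Y -> \det A <= \det Y.
Proof.
move=> Ap Yp AY; have [/real_spectral[U [v UvC]] _] := whiten_psd Ap Yp.
have := whiten_ge1 Ap AY => /(psdmx_diag (orthogonally_diagonalizes_sub1 UvC)) v1.
have : 1 <= \det (whiten A Y).
  rewrite (orthogonally_diagonalizes_det UvC); elim/big_rec: _ => // i x _ x1.
  have vi1 : 1 <= v 0 i by have := v1 i; rewrite !mxE subr_ge0.
  by rewrite mulr_ege1.
rewrite /whiten !det_mulmx mulrAC -det_mulmx mxpow_halfN// det_inv mulrC.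
by rewrite ler_pdivlMr ?mul1r// pdmx_det_gt0.
Qed.

(** The product on the left need not be symmetric. Splitting [mxpow A (- q)] into two halves and
    cycling one of them yields a congruence of [mxpow Y q], which is positive semidefinite. *)
Lemma tr_mxpow_mul A Y q : pdmx A -> psdmx Y ->
  \tr (mxpow Y q *m mxpow A (- q)) =
  \tr (mxpow A (- (q / 2)) *m mxpow Y q *m (mxpow A (- (q / 2)))^T).
Proof.
move=> Ap Yp; set S := mxpow A (- (q / 2)).
have SS : S *m S = mxpow A (- q).
  by rewrite (mxpowD _ _ Ap) (_ : _ + _ = - q)//; field.
have -> : S^T = S by exact: mxpow_tr.
rewrite -SS; clearbody S; move: (mxpow Y q) => B.
by rewrite mulmxA mxtrace_mulC mulmxA.
Qed.

Lemma tr_mxpow_mul_ge0 A Y q : pdmx A -> psdmx Y ->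
  0 <= \tr (mxpow Y q *m mxpow A (- q)).
Proof.
move=> Ap Yp; rewrite tr_mxpow_mul//; apply/psdmx_tr_ge0/psdmx_congr/mxfun_psd.
  by move=> t; exact: powR_ge0.
by case: Yp.
Qed.

Lemma tr_mxpow_mul_ge A Y q : pdmx A -> psdmx Y -> loewner_le A Y -> 0 <= q ->
  d%:R <= \tr (mxpow Y q *m mxpow A (- q)).
Proof.
move=> Ap Yp AY q0; rewrite tr_mxpow_mul//; apply: psdmx_det_ge1_tr.
  apply/psdmx_congr/mxfun_psd; last by case: Yp.
  by move=> t; exact: powR_ge0.
have dA := pdmx_det_gt0 Ap.
(* The two half powers recombine, so the determinant is that of [mxpow A (- q)] times that of
   [mxpow Y q]. *)
rewrite (mxpow_tr _ Ap) !det_mulmx mulrAC -det_mulmx (mxpowD _ _ Ap).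
rewrite (_ : _ + _ = - q); last by field.
rewrite (det_mxpow _ (pdmx_psdmx Ap)) (det_mxpow _ Yp).
rewrite powRN mulrC ler_pdivlMr ?powR_gt0// mul1r ge0_ler_powR ?nnegrE ?(ltW dA)//.
  exact: le_trans (ltW dA) (loewner_le_det Ap Yp AY).
exact: loewner_le_det.
Qed.

(** Reconciles the conjugated power with the ordinary square: inner factors pair up into [invmx A],
    and the leading pair cancels. *)
Lemma mxdiv_pow2 A Y : pdmx A -> psdmx Y -> mxdiv_pow Y A 2 = (Y *m invmx A) ^+ 2.
Proof.
move=> Ap Yp; have Cp := whiten_psd Ap Yp.
have C2 : mxpow (whiten A Y) 2 = whiten A Y *m whiten A Y.
  have [/real_spectral[U [v UvC]] _] := Cp; have v0 := (psdmx_diag UvC).1 Cp.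
  rewrite /mxpow (mxfunE _ UvC); case: UvC => UU ->.
  rewrite !mulmxA -(mulmxA _ U) UU mulmx1 -(mulmxA U^T (diag_mx v)) mulmx_diag.
  congr (_ *m _ *m _); congr diag_mx; apply/rowP => i; rewrite !mxE.
  by rewrite (powR_mulrn 2)// expr2.
rewrite /mxdiv_pow -/(whiten A Y) C2 /whiten expr2 -!mulmxE.
have A1 : mxpow A 2^-1 *m mxpow A (- 2^-1) = 1%:M.
  by rewrite (mxpowD _ _ Ap) addrN (mxpow0 Ap).
have := mxpow_halfN Ap; move: (mxpow A 2^-1) (mxpow A (- 2^-1)) A1 => S T ST <-.
by rewrite !mulmxA ST mul1mx.
Qed.

End FunctionalCalculus.

(** * The absolute value as a limit of polynomial iterates *)

Section AbsoluteValueIteration.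
Context {R : realType}.
Implicit Types k t : R.

(** Fixed-step iteration for [a * a = t * t]. Each iterate is a polynomial in [k] and [t], so the
    same recursion makes sense for matrices without diagonalizing them. *)
Definition abs_iter k t (n : nat) : R :=
  iter n (fun a => a + k * (t * t - a * a)) 0.

(* The errors satisfy |t| - a_(n+1) = (|t| - a_n) (1 - k (|t| + a_n)). *)
Lemma abs_iter_bounds k t n : 0 < k -> k * `|t| <= 2^-1 ->
  0 <= abs_iter k t n /\
  0 <= `|t| - abs_iter k t n <= `|t| * (1 - k * `|t|) ^+ n.
Proof.
move=> k0 kt; have t0 : 0 <= `|t| by [].
elim: n => [|n [a0 /andP[ta ta']]]; first by rewrite /= subr0 mulr1 lexx t0.
rewrite /= -/(abs_iter k t n); move: (abs_iter k t n) a0 ta ta' => a a0 ta ta'.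
have tt : t * t = `|t| * `|t| by rewrite -normrM ger0_norm// -expr2 sqr_ge0.
rewrite tt; move: (`|t|) kt t0 ta ta' => {tt}t kt t0 ta ta'.
have E : t - (a + k * (t * t - a * a)) = (t - a) * (1 - k * (t + a)) by ring.
have ka : k * a <= 2^-1 by apply: le_trans kt; rewrite ler_pM2l// -subr_ge0.
have ka0 : 0 <= k * a by rewrite mulr_ge0// ltW.
split.
  rewrite addr_ge0// mulr_ge0 ?(ltW k0)//.
  by rewrite (_ : _ - _ = (t - a) * (t + a)); [rewrite mulr_ge0// addr_ge0|ring].
(* Since [k * t] and [k * a] are at most 1/2 and [a] is nonnegative, the factor [1 - k * (t + a)]
   lies between 0 and [1 - k * t]. *)
rewrite E exprSr mulrA; apply/andP; split.
  by apply: mulr_ge0 => //; rewrite mulrDr; lra.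
by apply: ler_pM => //; rewrite mulrDr; lra.
Qed.

Lemma abs_iter_cvg k t : 0 < k -> k * `|t| <= 2^-1 ->
  abs_iter k t n @[n --> \oo] --> `|t|.
Proof.
move=> k0 kt; have H n := abs_iter_bounds n k0 kt.
(* At [t = 0] the geometric ratio is 1 and gives no decay, but the iterates are then constantly
   0. *)
have [t0|t0] := eqVneq `|t| 0.
  rewrite t0; rewrite (_ : abs_iter k t = fun=> 0); first exact: cvg_cst.
  apply/funext => n; have [_] := H n; rewrite t0 mul0r.
  by rewrite sub0r -eq_le eq_sym oppr_eq0 => /eqP.
have z1 : `|1 - k * `|t| | < 1.
  have : 0 < k * `|t| by rewrite mulr_gt0// lt_def t0 normr_ge0.
  by rewrite ltr_norml; lra.
apply: (@squeeze_cvgr _ _ _ _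
  (fun n => `|t| - geometric `|t| (1 - k * `|t|) n) (fun=> `|t|)).
- apply: nearW => n /=; have [_ /andP[ge0 le]] := H n.
  by rewrite lerBlDr addrC -lerBlDr le -subr_ge0.
- rewrite -[X in _ --> X]subr0; apply: cvgB; first exact: cvg_cst.
  exact: cvg_geometric.
- exact: cvg_cst.
Qed.

Definition mxabs_iter {d} k (Z : 'M[R]_d) (n : nat) : 'M[R]_d :=
  iter n (fun M => M + k *: (Z *m Z - M *m M)) 0.

Lemma mxabs_iterE {d} k (Z : 'M[R]_d) U v n : orthogonally_diagonalizes U v Z ->
  mxabs_iter k Z n = U^T *m diag_mx (map_mx (abs_iter k ^~ n) v) *m U.
Proof.
move=> [UU ->]; elim: n => [|n IHn] /=.
  rewrite (_ : map_mx _ _ = 0) ?linear0 ?mulmx0 ?mul0mx//.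
  by apply/rowP => i; rewrite !mxE.
have sq (v1 : 'rV[R]_d) : (U^T *m diag_mx v1 *m U) *m (U^T *m diag_mx v1 *m U) =
    U^T *m diag_mx (map_mx (fun t => t * t) v1) *m U.
  rewrite !mulmxA -(mulmxA _ U) UU mulmx1 -(mulmxA U^T) mulmx_diag.
  by congr (_ *m _ *m _); congr diag_mx; apply/rowP => i; rewrite !mxE.
rewrite -/(mxabs_iter k _ n) IHn !sq -mulmxBl -mulmxBr scalemxAl scalemxAr.
rewrite -mulmxDl -mulmxDr.
congr (_ *m _ *m _); rewrite -linearB -linearZ -linearD; congr diag_mx.
by apply/rowP => i; rewrite !mxE.
Qed.

(** The trace of [Z *m Z] is the sum of the squared eigenvalues, so this step size suits all of them
    at once while depending only on the entries of [Z]. *)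
Lemma mxabs_iter_cvg {d} (Z : 'M[R]_d) i j : Z \is symmetricmx ->
  mxabs_iter (2^-1 * (1 + \tr (Z *m Z)) `^ (-1)) Z n i j @[n --> \oo] -->
  mxabs Z i j.
Proof.
move=> /real_spectral[U [v UvZ]].
have trE : \tr (Z *m Z) = \sum_k v 0 k ^+ 2.
  case: (UvZ) => UU ->; rewrite !mulmxA -(mulmxA _ U) UU mulmx1.
  rewrite -(mulmxA U^T) mulmx_diag mxtrace_mulC mulmxA UU mul1mx mxtrace_diag.
  by apply: eq_bigr => l _; rewrite mxE.
have tr0 : 0 <= \tr (Z *m Z) by rewrite trE sumr_ge0// => l _; exact: sqr_ge0.
rewrite powR_inv1 ?addr_ge0//; set k := _ * _.
have k0 : 0 < k by rewrite mulr_gt0// invr_gt0 ltr_wpDr.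
have kv l : k * `|v 0 l| <= 2^-1.
  rewrite /k -mulrA ler_piMr// ler_pdivrMl ?ltr_wpDr// mulr1 trE (bigD1 l)//=.
  have : 0 <= \sum_(j0 | j0 != l) v 0 j0 ^+ 2.
    by apply: sumr_ge0 => ? _; exact: sqr_ge0.
  move: (\sum_(_ | _) _) => s s0.
  (* With [u] the absolute value of the eigenvalue, the square of [u - 1] being nonnegative gives
     [2 * u <= 1 + u ^+ 2]. *)
  rewrite -[v 0 l ^+ 2]real_normK ?num_real//; have := sqr_ge0 (`|v 0 l| - 1).
  have := normr_ge0 (v 0 l); nra.
have entry (f : R -> R) : (U^T *m diag_mx (map_mx f v) *m U) i j =
    \sum_l U l i * f (v 0 l) * U l j.
  by rewrite mxE; apply: eq_bigr => l _; rewrite mul_mx_diag !mxE.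
rewrite /mxabs (mxfunE _ UvZ) entry.
rewrite (_ : (fun n => _) =
    \sum_l (fun n => U l i * abs_iter k (v 0 l) n * U l j)); last first.
  by apply/funext => n; rewrite (mxabs_iterE _ _ UvZ) entry fct_sumE.
elim/big_ind2: _ => [|f a g b|l _]; [exact: cvg_cst|exact: cvgD|].
by apply: cvgMr_tmp; apply: cvgMl_tmp; exact: abs_iter_cvg.
Qed.

End AbsoluteValueIteration.

(** * Measurability, expectation and Markov's inequality for random matrices *)

Section RandomMatrices.
Context {disp : measure_display} {T : measurableType disp} {R : realType}.
Context {d : nat}.
Implicit Types (P : probability T R) (X Y Z M : T -> 'M[R]_d) (A B : 'M[R]_d).

Definition measurable_mx Z :=
  forall i j, measurable_fun setT (fun w => Z w i j).

Lemma measurable_mx_cst A : measurable_mx (fun=> A).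
Proof. by move=> i j; exact: measurable_cst. Qed.

Lemma measurable_mxD Y Z : measurable_mx Y -> measurable_mx Z ->
  measurable_mx (fun w => Y w + Z w).
Proof.
move=> mY mZ i j; under eq_fun do rewrite mxE; exact: measurable_funD.
Qed.

Lemma measurable_mxB Y Z : measurable_mx Y -> measurable_mx Z ->
  measurable_mx (fun w => Y w - Z w).
Proof.
move=> mY mZ i j; under eq_fun do rewrite !mxE; exact: measurable_funB.
Qed.

Lemma measurable_mxZ (k : T -> R) Z : measurable_fun setT k -> measurable_mx Z ->
  measurable_mx (fun w => k w *: Z w).
Proof.
move=> mk mZ i j; under eq_fun do rewrite mxE; exact: measurable_funM.
Qed.

Lemma measurable_mxM Y Z : measurable_mx Y -> measurable_mx Z ->
  measurable_mx (fun w => Y w *m Z w).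
Proof.
move=> mY mZ i j; under eq_fun do rewrite mxE.
by apply: measurable_sum => l; exact: measurable_funM.
Qed.

Lemma measurable_mx_tr Z : measurable_mx Z ->
  measurable_fun setT (fun w => \tr (Z w)).
Proof. by move=> mZ; apply: measurable_sum => i; exact: mZ. Qed.

Lemma measurable_mxabs Z : measurable_mx Z -> (forall w, Z w \is symmetricmx) ->
  measurable_mx (fun w => mxabs (Z w)).
Proof.
move=> mZ sZ i j.
(* The step size adapts to [w], as the eigenvalues of [Z w] may be unbounded. The inverse is written
   as a real power so that [measurable_powR] applies. *)
pose k w := 2^-1 * (1 + \tr (Z w *m Z w)) `^ (-1).
apply: (@measurable_fun_cvg _ _ _ _
  (fun n w => mxabs_iter (k w) (Z w) n i j)); last first.
  by move=> w _; exact: mxabs_iter_cvg.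
have mk : measurable_fun setT k.
  apply: measurable_funM; first exact: measurable_cst.
  apply: (measurableT_comp (measurable_powR (-1))); apply: measurable_funD.
    exact: measurable_cst.
  exact/measurable_mx_tr/measurable_mxM.
move=> n; move: i j; elim: n => [|n IHn]; first exact: measurable_mx_cst.
apply: measurable_mxD => //; apply: measurable_mxZ => //.
by apply: measurable_mxB; exact: measurable_mxM.
Qed.

(** The definition quantifies over all vectors; the trace criterion replaces this by one inequality
    between measurable functions. *)
Lemma measurable_psdmx Z : measurable_mx Z -> (forall w, Z w \is symmetricmx) ->
  measurable [set w | psdmx (Z w)].
Proof.
move=> mZ sZ.
have -> : [set w | psdmx (Z w)] =
    setT `&` (fun w => \tr (mxabs (Z w)) <= \tr (Z w)) @^-1` [set true].
  rewrite setTI; apply/seteqP; split=> w /=.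
    by move/(psdmx_tr_mxabs (sZ w)).
  by move=> ?; apply/(psdmx_tr_mxabs (sZ w)).
apply: measurable_fun_ler => //; apply: measurable_mx_tr => //.
exact: measurable_mxabs.
Qed.

(** The trace is a finite linear combination of the entries of [M w] with deterministic
    coefficients, so linearity of the integral applies. *)
Lemma integral_tr_mul P M B : mx_integrable P M ->
  P.-integrable setT (fun w => (\tr (M w *m B))%:E) /\
  (\int[P]_w (\tr (M w *m B))%:E)%E = (\tr (mx_expectation P M *m B))%:E.
Proof.
move=> iM.
have trE (N : 'M[R]_d) : (\tr (N *m B))%:E =
    (\sum_i \sum_j (B j i)%:E * (N i j)%:E)%E.
  rewrite /mxtrace -sumEFin; apply: eq_bigr => i _.
  by rewrite mxE -sumEFin; apply: eq_bigr => j _; rewrite mulrC EFinM.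
have iMB i j : P.-integrable setT (fun w => (B j i)%:E * (M w i j)%:E)%E.
  exact: integrableZl.
have iS i : P.-integrable setT (fun w => \sum_j (B j i)%:E * (M w i j)%:E)%E.
  by apply: integrable_sum => // j _; exact: iMB.
under eq_fun do rewrite trE; split; first exact: integrable_sum.
rewrite trE.
rewrite integral_sum//; apply: eq_bigr => i _.
rewrite integral_sum//; apply: eq_bigr => j _.
(* Integrability makes the expectation of each entry finite, so [fine] loses nothing. *)
rewrite integralZl// mxE fineK; first by rewrite unlock.
by rewrite unlock; exact: integrable_fin_num.
Qed.

(** The indicator of [E] is pointwise at most the trace divided by [d]; integrating gives the bound.
    The factor [B] accommodates both the identity and [mxpow A (- q)]. *)
Lemma trace_markov P M B (E : set T) : (0 < d)%N -> measurable E ->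
  mx_integrable P M -> (forall w, 0 <= \tr (M w *m B)) ->
  (forall w, E w -> d%:R <= \tr (M w *m B)) ->
  (P E <= (d%:R^-1 * \tr (mx_expectation P M *m B))%:E)%E.
Proof.
move=> d0 mE iM tr0 trd; have [iMB intE] := integral_tr_mul B iM.
have dR0 : 0 < d%:R :> R by rewrite ltr0n.
rewrite EFinM -intE -integralZl// -[E in leLHS]setIT -integral_indic//.
apply: ge0_le_integral => //.
- by apply/measurable_EFinP; apply: measurable_indic.
- by apply: (measurable_int P); exact: integrableZl.
move=> w _; rewrite -EFinM lee_fin indicE mulrC ler_pdivlMr//.
by case: (boolP (w \in E)) => [/set_mem/trd|_]; rewrite ?mul1r ?mul0r.
Qed.

End RandomMatrices.

Theorem theorem2p3 (disp : measure_display) (T : measurableType disp)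
    (R : realType) (P : probability T R) (d : nat) (hd : (0 < d)%N)
    (X : T -> 'M[R]_d) (A : 'M[R]_d)
    (hX : random_symmx X) (hEX : mx_integrable P X) (hA : pdmx A) :
  let Y := fun w : T => mxabs (X w - mx_expectation P X) in
  (mx_integrable P (fun w => (Y w *m invmx A) ^+ 2) ->
    (P [set w | A ⪯ Y w] <=
      (d%:R^-1 * \tr (mx_expectation P (fun w => (Y w *m invmx A) ^+ 2)))%:E)%E)
  /\
  (forall p : R, 1 <= p ->
    mx_integrable P (fun w => mxdiv_pow (Y w) A p) ->
    (P [set w | A ⪯ Y w] <=
      (d%:R^-1 * \tr (mx_expectation P (fun w => mxdiv_pow (Y w) A p)))%:E)%E)
  /\
  (forall q : R, 0 < q -> q <= 1 ->
    mx_integrable P (fun w => mxpow (Y w) q) ->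
    (P [set w | A ⪯ Y w] <=
      (d%:R^-1 * \tr (mx_expectation P (fun w => mxpow (Y w) q)
                        *m mxpow A (- q)))%:E)%E).
Proof.
move=> Y; case: hX => mX sX.
have sE : mx_expectation P X \is symmetricmx.
  apply/symmetricmxP/matrixP => i j; rewrite !mxE; congr (fine (expectation _ _)).
  by apply/funext => w; rewrite -[in LHS](symmetricmxP _ (sX w)) mxE.
have sZ w : X w - mx_expectation P X \is symmetricmx by exact: symmetricmxB.
have pY w : psdmx (Y w) by exact: mxfun_psd.
have mY : measurable_mx Y.
  apply: measurable_mxabs => //.
  by apply: measurable_mxB => //; exact: measurable_mx_cst.
have mE : measurable [set w | A ⪯ Y w].
  apply: measurable_psdmx => [|w].
    by apply: measurable_mxB => //; exact: measurable_mx_cst.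
  by apply: symmetricmxB; [case: (pY w)|case: hA].
have power p : 1 <= p -> mx_integrable P (fun w => mxdiv_pow (Y w) A p) ->
    (P [set w | A ⪯ Y w] <=
      (d%:R^-1 * \tr (mx_expectation P (fun w => mxdiv_pow (Y w) A p)))%:E)%E.
  (* Here [A] is already inside the expectation, so [trace_markov] is used with [B] the identity. *)
  move=> p1 iY; rewrite -[mx_expectation _ _]mulmx1.
  apply: trace_markov => // w; first by rewrite mulmx1 tr_mxdiv_pow_ge0.
  by move=> /= AY; rewrite mulmx1 tr_mxdiv_pow_ge// (le_trans ler01).
split; last split=> // q q0 _ iY.
  have -> : (fun w => (Y w *m invmx A) ^+ 2) = (fun w => mxdiv_pow (Y w) A 2).
    by apply/funext => w; rewrite mxdiv_pow2.
  by apply: power; rewrite ler1n.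
apply: trace_markov => // w; first exact: tr_mxpow_mul_ge0.
by move=> /= AY; apply: tr_mxpow_mul_ge => //; exact: ltW.
Qed.
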